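(* Let $G$ be a snark which has a normal $5$-edge-coloring $\sigma$ and let $C$ be a cycle of even length in $G$. Then every $\tilde{G}\in\mathcal{G}_{C}(\mathcal{A},\mathcal{B})$ has a normal $5$-edge-coloring $\tilde{\sigma}$ such that $\tilde{\sigma}(e)=\sigma(e)$ for every $e\in E(G)\setminus E(C)$ and such that $\tilde{\sigma}$ has at least $18$ poor edges.
   Context: All graphs are simple, cubic and bridgeless. A snark is a bridgeless cubic graph that is not $3$-edge-colorable (no further girth or connectivity requirement). A (proper) $k$-edge-coloring of a graph $G$ is a map $\sigma:E(G)\to\{1,\dots,k\}$ giving distinct colors to adjacent edges. For a vertex $v$, $\sigma(v)$ denotes the set of colors of the three edges incident to $v$. An edge $uv$ is poor if $|\sigma(u)\cup\sigma(v)|=3$ and rich if $|\sigma(u)\cup\sigma(v)|=5$; it is normal if it is poor or rich. The coloring $\sigma$ is normal if every edge is normal. The family $\mathcal{G}_C(\mathcal{A},\mathcal{B})$ (superpositions of $G$ along $C$, where each edge of $C$ is replaced by the superedge $B$, obtained from the Petersen graph by removing two non-adjacent vertices, and each vertex of $C$ is replaced by one of the two supervertices $A$, $A'$): let $C=u_0u_1\cdots u_{g-1}u_0$ be a cycle of length $g$ in $G$, with indices modulo $g$, and let $v_i$ be the neighbor of $u_i$ distinct from $u_{i-1}$ and $u_{i+1}$ (possibly $v_i=u_j$ for some $j\notin\{i-1,i,i+1\}$, and possibly $v_i=v_j$ for $i\neq j$). For each $i$ choose a type $\mathcal{A}_i\in\{A,A'\}$ independently. The corresponding graph $\tilde G$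 is obtained from $G$ as follows. (1) Delete all edges $u_iu_{i+1}$ of $C$ (all vertices of $G$ and all edges of $E(G)\setminus E(C)$, including the edges $u_iv_i$, are kept). (2) For each $i$ (representing the superedge $\mathcal{B}_i$ replacing $u_iu_{i+1}$) add eight new vertices $a_i,b_i,c_i,d_i,e_i,f_i,g_i,h_i$ and the nine edges $a_ib_i,\ b_ie_i,\ b_if_i,\ c_id_i,\ c_if_i,\ d_ie_i,\ e_ig_i,\ f_ih_i,\ g_ih_i$. (3) For each $i$ add the edges $u_ia_i$ and $a_iu_{i+1}$. (4) For each $i$ with $\mathcal{A}_i=A$ add the edges $d_{i-1}c_i$ and $h_{i-1}g_i$. (5) For each $i$ with $\mathcal{A}_i=A'$ add two new vertices $u_i',u_i''$ and the edges $d_{i-1}u_i',\ u_i'c_i,\ h_{i-1}u_i'',\ u_i''g_i,\ u_i'u_i''$. The family $\mathcal{G}_C(\mathcal{A},\mathcal{B})$ consists of all graphs $\tilde G$ so obtained, over all choices of types. By construction $E(G)\setminus E(C)\subseteq E(\tilde G)$. *)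

(* Defs.v *)
(* Mathematical Components *)
From HB Require Import structures.
From mathcomp Require Import all_boot.

Set Implicit Arguments.
Unset Strict Implicit.
Unset Printing Implicit Defensive.

Record sgraph := SGraph {
  vertex :> finType;
  adj : rel vertex;
  adj_sym : symmetric adj;
  adj_irr : irreflexive adj
}.

Section Graphs.
Variable G : sgraph.

Definition edges : {set {set G}} :=
  [set a | [exists x : G, exists y : G, adj x y && (a == [set x; y])]].

Definition cubic := forall x : G, #|[set y | adj x y]| = 3.

(* An edge is a bridge when deleting it separates its ends. *)
Definition bridgeless := forall x y : G, adj x y ->
  connect (fun v w => adj v w && ([set v; w] != [set x; y])) x y.

(* Colorings are total functions on vertex sets; only their values on the
   members of [edges] matter. *)
Definition edge_coloring (k : nat) (s : {set G} -> 'I_k) := forall a b,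
  a \in edges -> b \in edges -> a != b -> a :&: b != set0 -> s a != s b.

Definition snark :=
  [/\ cubic, bridgeless & ~ exists s : {set G} -> 'I_3, edge_coloring s].

Section Normal.
Variables (k : nat) (s : {set G} -> 'I_k).

Definition vcolors (v : G) : {set 'I_k} := [set s a | a in edges & v \in a].

(* For an edge a = uv this is the union of the color sets of u and v. *)
Definition ecolors (a : {set G}) : {set 'I_k} := \bigcup_(v in a) vcolors v.

Definition poor (a : {set G}) := #|ecolors a| == 3.
Definition rich (a : {set G}) := #|ecolors a| == 5.

Definition normal_coloring :=
  edge_coloring s /\ forall a, a \in edges -> poor a || rich a.

Definition poor_edges : {set {set G}} := [set a in edges | poor a].

End Normal.

(* [ordS] and [ord_pred] are successor and predecessor modulo g. *)
Definition is_cycle (g : nat) (u : 'I_g -> G) :=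
  [/\ 2 < g, injective u & forall i, adj (u i) (u (ordS i))].

Definition cycle_edges (g : nat) (u : 'I_g -> G) : {set {set G}} :=
  [set [set u i; u (ordS i)] | i : 'I_g].

End Graphs.

Variant label := La | Lb | Lc | Ld | Le | Lf | Lg | Lh.

Definition label_code (l : label) : 'I_8 :=
  match l with
  | La => @Ordinal 8 0 isT
  | Lb => @Ordinal 8 1 isT
  | Lc => @Ordinal 8 2 isT
  | Ld => @Ordinal 8 3 isT
  | Le => @Ordinal 8 4 isT
  | Lf => @Ordinal 8 5 isT
  | Lg => @Ordinal 8 6 isT
  | Lh => @Ordinal 8 7 isT
  end.

Definition label_decode (n : 'I_8) : label :=
  nth La [:: La; Lb; Lc; Ld; Le; Lf; Lg; Lh] n.

Lemma label_codeK : cancel label_code label_decode.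
Proof. by case. Qed.

HB.instance Definition _ := Finite.copy label (can_type label_codeK).

Variant svtype := SvA | SvA'.

Definition isA' (t : svtype) : bool := if t is SvA' then true else false.

(* The nine edges inside the superedge (Petersen graph minus two non-adjacent
   vertices), each in one orientation. *)
Definition superedge_arc (l m : label) : bool :=
  match l, m with
  | La, Lb | Lb, Le | Lb, Lf | Lc, Ld | Lc, Lf
  | Ld, Le | Le, Lg | Lf, Lh | Lg, Lh => true
  | _, _ => false
  end.

(* The links d_(i-1) c_i and h_(i-1) g_i between consecutive superedges. *)
Definition link_arc (l m : label) : bool :=
  match l, m with
  | Ld, Lc | Lh, Lg => true
  | _, _ => false
  end.

Section Superposition.
Variables (G : sgraph) (g : nat) (u : 'I_g -> G) (typ : 'I_g -> svtype).

(* [New i l] is the vertex labelled l of the i-th superedge; [Ext i false] and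
   [Ext i true] are u_i' and u_i'', present only at indices of type A'. *)
Inductive svertex :=
  | Old of G
  | New of 'I_g & label
  | Ext of {i : 'I_g | isA' (typ i)} & bool.

Definition svertex_code (x : svertex) :
    G + ('I_g * label) + ({i : 'I_g | isA' (typ i)} * bool) :=
  match x with
  | Old v => inl (inl v)
  | New i l => inl (inr (i, l))
  | Ext i b => inr (i, b)
  end.

Definition svertex_decode
    (x : G + ('I_g * label) + ({i : 'I_g | isA' (typ i)} * bool)) : svertex :=
  match x with
  | inl (inl v) => Old v
  | inl (inr (i, l)) => New i l
  | inr (i, b) => Ext i b
  end.

Lemma svertex_codeK : cancel svertex_code svertex_decode.
Proof. by case. Qed.

HB.instance Definition _ := Finite.copy svertex (can_type svertex_codeK).

(* Each edge of the superposition in one orientation: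
   - Old/Old: the edges of G outside the cycle;
   - Old/New: u_i a_i and u_(i+1) a_i;
   - New/New: the superedges, and d_(i-1) c_i, h_(i-1) g_i for type A;
   - New/Ext, Ext/New, Ext/Ext: d_(i-1) u_i', h_(i-1) u_i'', u_i' c_i,
     u_i'' g_i and u_i' u_i'' for type A'. *)
Definition sarc (x y : svertex) : bool :=
  match x, y with
  | Old v, Old w => adj v w && ([set v; w] \notin cycle_edges u)
  | Old v, New i La => (v == u i) || (v == u (ordS i))
  | New j l, New i m =>
      (j == i) && superedge_arc l m
      || [&& ~~ isA' (typ i), j == ord_pred i & link_arc l m]
  | New j l, Ext i b =>
      (j == ord_pred (val i)) && (l == if b then Lh else Ld)
  | Ext i b, New j l => (val i == j) && (l == if b then Lg else Lc)
  | Ext i b, Ext j c => [&& i == j, ~~ b & c]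
  | _, _ => false
  end.

Definition sadj : rel svertex := fun x y => sarc x y || sarc y x.

Lemma sadj_sym : symmetric sadj.
Proof. by move=> x y; rewrite /sadj orbC. Qed.

Lemma sadj_irr : irreflexive sadj.
Proof.
move=> x; rewrite /sadj orbb; case: x => [v|i l|i b] /=.
- by rewrite adj_irr.
- by case: l; rewrite ?andbF.
- by case: b; rewrite ?andbF.
Qed.

Definition superposition : sgraph := SGraph sadj_sym sadj_irr.

(* The copy in the superposition of an edge of G outside the cycle. *)
Definition old_edge (a : {set G}) : {set superposition} :=
  [set (Old v : superposition) | v in a].

End Superposition.

(* Main.v *)
Require Import Defs.
From HB Require Import structures.
From mathcomp Require Import all_boot.

(** The new coloring copies, at every vertex of the superposition, the color
    set of some vertex of G.  Each vertex x of the superposition H has a shadow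
    in G: an old vertex is its own shadow, and the new vertices of index i have
    theirs at u_i or u_(i+1).  The shadows of adjacent vertices are equal or
    adjacent ([shadow_adj]).  If the three edges at every x get exactly the three
    colors that sigma shows at the shadow of x ([star]), then normality costs
    nothing: the coloring is proper at x because three edges share three colors,
    an edge whose ends have the same shadow is poor, and any other edge sees the
    same two color sets as an edge of G, which is normal ([recolor_normal]).

    It remains to find shadows and colors.  Since the cycle is even, its edges
    can be grouped in pairs around the vertices u_m with m odd.  Write alpha,
    beta, gamma for the colors at u_m of u_(m-1) u_m, of u_m u_(m+1) and of the
    third edge.  The two superedges at u_m both use alpha on u_i a_i, beta on
    a_i u_(i+1) and gamma on a_i b_i, so that every u_i keeps its color set, the
    two cycle colors being swapped when i is odd.
    - For i even, every vertex of the superedge has shadow u_(i+1).  The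
      superedge is 3-edge-colored with alpha, beta and gamma.  It takes two
      links of the same color on its left and gives alpha and beta on its right,
      in the order that suits the type of the next supervertex.
    - For i odd, the vertices a, b, c, f have shadow u_i, while d, e, g, h have
      shadow u_(i+1).  The links on the right both carry the color of
      u_(i+1) u_(i+2), as if that edge were tripled, and thus they fit the next
      pair whatever its colors are.

    All nine edges of a superedge of even index are poor.  An even cycle has
    length at least 4, hence two even indices, which yield 18 poor edges. *)

Set Implicit Arguments.
Unset Strict Implicit.
Unset Printing Implicit Defensive.

(** * Edges and color sets *)

Lemma mem_edges (G : sgraph) (x y : G) : adj x y -> [set x; y] \in edges G.
Proof.
move=> xy; rewrite inE; apply/existsP; exists x.
by apply/existsP; exists y; rewrite xy /=.
Qed.

Lemma edgesP (G : sgraph) (a : {set G}) :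
  reflect (exists x y : G, adj x y /\ a = [set x; y]) (a \in edges G).
Proof.
rewrite inE; apply: (iffP existsP) => [[x /existsP[y /andP[xy /eqP->]]]|].
  by exists x, y.
by case=> x [y [xy ->]]; exists x; apply/existsP; exists y; rewrite xy /=.
Qed.

Lemma set2_eq (T : finType) (x y v w : T) :
  [set x; y] = [set v; w] -> x != y ->
  (x = v /\ y = w) \/ (x = w /\ y = v).
Proof.
move=> e nxy; have := set21 x y; have := set22 x y; rewrite e !inE.
case/orP=> /eqP ey; case/orP=> /eqP ex; subst; rewrite ?eqxx // in nxy; auto.
Qed.

Lemma adj_neq (G : sgraph) (x y : G) : adj x y -> x != y.
Proof. by move=> xy; apply/eqP=> e; move: xy; rewrite e adj_irr. Qed.

Lemma edge_at (G : sgraph) (a : {set G}) (x : G) :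
  a \in edges G -> x \in a -> exists2 y, adj x y & a = [set x; y].
Proof.
case/edgesP=> v [w [vw ->]]; rewrite !inE => /orP[]/eqP->; first by exists w.
by exists v; [rewrite adj_sym | rewrite setUC].
Qed.

Lemma vcolorsE (G : sgraph) k (s : {set G} -> 'I_k) (x : G) :
  vcolors s x = [set s [set x; y] | y in adj x].
Proof.
apply/setP=> c; apply/imsetP/imsetP => [[a]|[y xy ->]].
  rewrite inE => /andP[ae xa] ->.
  by have [y xy ->] := edge_at ae xa; exists y.
by exists [set x; y] => //; rewrite inE mem_edges //= set21.
Qed.

Lemma card_vcolors (G : sgraph) k (s : {set G} -> 'I_k) (v : G) :
  cubic G -> edge_coloring s -> #|vcolors s v| = 3.
Proof.
move=> G_cubic proper.
rewrite vcolorsE card_in_imset; first by have := G_cubic v; rewrite cardsE.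
move=> y z; rewrite -!topredE /= => vy vz e; apply/eqP/negP=> /negP nyz.
have ne : [set v; y] != [set v; z].
  apply: contraNneq nyz => e2.
  by case: (set2_eq e2 (adj_neq vy)) => -[e3 e4]; subst; rewrite eqxx.
have /negP : s [set v; y] != s [set v; z].
  apply: proper; rewrite ?mem_edges //.
  by apply/set0Pn; exists v; rewrite !inE !eqxx.
by rewrite e eqxx.
Qed.

(** * Colorings pulled back along a shadow map *)

Section Recoloring.
Variables (G H : sgraph) (k : nat) (s : {set G} -> 'I_k).
Variables (rho : H -> G) (f : H -> H -> 'I_k).

(** The bound on the number of neighbors, together with the color set of
    [rho x], which has three elements when G is cubic, forces the colors at x to
    be distinct; so only the set of colors has to be checked. *)
Definition star_copy (x : H) := exists ns : seq H,
  [/\ size ns <= 3, forall y, adj x y = (y \in ns) &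
      vcolors s (rho x) = [set f x y | y in ns]].

Hypothesis s_normal : normal_coloring s.
Hypothesis G_cubic : cubic G.
Hypothesis f_sym : forall x y, adj x y -> f x y = f y x.
Hypothesis rho_adj : forall x y,
  adj x y -> rho x = rho y \/ adj (rho x) (rho y).
Hypothesis rho_star : forall x, star_copy x.

Let card_s (v : G) : #|vcolors s v| = 3.
Proof. by apply: card_vcolors => //; case: s_normal. Qed.

(** Turns a symmetric function on ordered pairs of adjacent vertices into a
    coloring of edges as vertex sets; d is a default value, taken on the sets
    that are not edges. *)
Definition recolor (d : 'I_k) (a : {set H}) : 'I_k :=
  if [pick p : H * H | adj p.1 p.2 && (a == [set p.1; p.2])] is Some p
  then f p.1 p.2 else d.

Lemma recolorE d x y : adj x y -> recolor d [set x; y] = f x y.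
Proof.
move=> xy; rewrite /recolor; case: pickP => [[v w] /= /andP[vw /eqP e]|].
  by case: (set2_eq e (adj_neq xy)) => -[-> ->] //; apply: f_sym.
by move/(_ (x, y)); rewrite /= xy eqxx.
Qed.

Lemma recolor_vcolors d x : vcolors (recolor d) x = vcolors s (rho x).
Proof.
have [ns [_ nsE ->]] := rho_star x; rewrite vcolorsE.
apply/setP=> c; apply/imsetP/imsetP=> -[y ny ->]; exists y.
- by rewrite -nsE.
- exact: recolorE.
- by rewrite -topredE /= nsE.
- by rewrite recolorE // nsE.
Qed.

Lemma star_inj x y z : adj x y -> adj x z -> f x y = f x z -> y = z.
Proof.
have [ns [ns3 nsE cE]] := rho_star x; rewrite !nsE.
have /imset_injP inj : #|[set f x y | y in [set w in ns]]| == #|[set w in ns]|.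
  have -> : [set f x y | y in [set w in ns]] = vcolors s (rho x).
    rewrite cE; apply/setP=> c.
    by apply/imsetP/imsetP=> -[w wns ->]; exists w; rewrite // inE in wns *.
  rewrite eqn_leq card_s cardsE (leq_trans (card_size ns)) // andbT.
  by rewrite -(card_s (rho x)) cE leq_imset_card.
by move=> y1 z1; apply: inj; rewrite inE.
Qed.

(** Normality of an edge depends only on the color sets of its ends, hence only
    on the shadows of its ends. *)
Lemma recolor_ecolors d x y :
  ecolors (recolor d) [set x; y] = ecolors s [set rho x; rho y].
Proof. by rewrite /ecolors !bigcup_setU !big_set1 !recolor_vcolors. Qed.

Lemma recolor_poor d x y : rho x = rho y -> poor (recolor d) [set x; y].
Proof.
move=> e; rewrite /poor recolor_ecolors e setUid /ecolors big_set1.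
by rewrite card_s.
Qed.

Lemma recolor_normal d : normal_coloring (recolor d).
Proof.
split=> [a b ae be nab /set0Pn[x]|a /edgesP[x [y [xy ->]]]].
  rewrite inE => /andP[xa xb].
  have [y xy ea] := edge_at ae xa; have [z xz eb] := edge_at be xb.
  rewrite ea eb !recolorE //; apply: contraNneq nab => e.
  by rewrite ea eb (star_inj xy xz e).
case: (rho_adj xy) => [e|e]; first by rewrite recolor_poor.
have [_ /(_ _ (mem_edges e))] := s_normal.
by rewrite /poor /rich recolor_ecolors.
Qed.

End Recoloring.

(** * Even cycles in a cubic graph *)

Section CyclicIndex.
Variables (g : nat) (i : 'I_g).

Lemma odd_ordS : ~~ odd g -> odd (ordS i) = ~~ odd i.
Proof. by move=> g_even; rewrite /= odd_mod // (negPf g_even). Qed.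

Lemma ordSS_neq : 2 < g -> ordS (ordS i) != i.
Proof.
move=> g2; rewrite -val_eqE /= -addn1 modnDml addn1; apply/eqP=> e.
have : i.+2 == i %[mod g] by rewrite e modn_small.
by rewrite -addn2 -[X in _ == X %[mod _]]addn0 eqn_modDl mod0n modn_small.
Qed.

End CyclicIndex.

Lemma odd_ord_pred g (i : 'I_g) : ~~ odd g -> odd (ord_pred i) = ~~ odd i.
Proof. by move=> g_even; rewrite -[in RHS](ord_predK i) odd_ordS // negbK. Qed.

Section Cycle.
Variables (G : sgraph) (g : nat) (u : 'I_g -> G).
Hypotheses (G_cubic : cubic G) (u_cycle : is_cycle u).

Lemma cycle_third (i : 'I_g) : exists v : G,
  [/\ v != u (ord_pred i), v != u (ordS i) &
      forall w, adj (u i) w = (w \in [:: u (ord_pred i); u (ordS i); v])].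
Proof.
have [g2 u_inj u_adj] := u_cycle.
have adjS := u_adj i.
have adjP : adj (u i) (u (ord_pred i)).
  by rewrite adj_sym -[X in adj _ (u X)]ord_predK u_adj.
have neqSP : u (ordS i) != u (ord_pred i).
  by rewrite (inj_eq u_inj) -[X in ordS X]ord_predK ordSS_neq.
pose N := [set w | adj (u i) w].
have := G_cubic (u i); rewrite -/N (cardsD1 (u (ord_pred i))) inE adjP.
rewrite (cardsD1 (u (ordS i))) !inE neqSP adjS /= !add1n.
case=> /eqP/cards1P[v Nv].
have := set11 v; rewrite -Nv !inE => /and3P[vS vP vN].
exists v; split=> // w; rewrite !inE.
move/setP/(_ w): Nv; rewrite !inE.
have [->|nS] := eqVneq w (u (ordS i)); first by rewrite adjS orbT.
by have [->|nP] := eqVneq w (u (ord_pred i)).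
Qed.

End Cycle.

(** * Colors and shadows in the superposition *)

Section Lift.
Variables (G : sgraph) (sigma : {set G} -> 'I_5).
Variables (g : nat) (u : 'I_g -> G) (typ : 'I_g -> svtype).
Hypotheses (G_cubic : cubic G).
Hypotheses (u_cycle : is_cycle u) (g_even : ~~ odd g).
Variable v : 'I_g -> G.
Hypothesis v_third : forall i,
  [/\ v i != u (ord_pred i), v i != u (ordS i) &
      forall w, adj (u i) w = (w \in [:: u (ord_pred i); u (ordS i); v i])].

Local Notation rim i := (sigma [set u i; u (ordS i)]).
Local Notation spoke i := (sigma [set u i; v i]).
Local Notation H := (superposition u typ).
Local Notation new := (@New G g typ).
Local Notation old := (@Old G g typ).
Local Notation ext := (@Ext G g typ).

(** Superedges i and i+1 with i even form a pair; both are colored in terms of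
    the colors at the vertex between them. *)
Definition odd_end (i : 'I_g) := if odd i then i else ordS i.

Definition shadow (x : svertex G typ) : G :=
  match x with
  | Old w => w
  | New i (Ld | Le | Lg | Lh) => if odd i then u (ordS i) else u (odd_end i)
  | New i _ => u (odd_end i)
  | Ext e _ => u (odd_end (val e))
  end.

Definition alpha i := rim (ord_pred (odd_end i)).
Definition beta i := rim (odd_end i).
Definition gamma i := spoke (odd_end i).

(** For i even, the colors of the links leaving d_i and h_i.  When supervertex
    i+1 is of type A', its two extra vertices get the color set
    {alpha, beta, gamma} with gamma on the edge between them, so that alpha and
    beta are exchanged along both links.  The order is reversed in advance, and
    the links always enter c_(i+1) with alpha and g_(i+1) with beta. *)
Definition even_d i := if isA' (typ (ordS i)) then beta i else alpha i.
Definition even_h i := if isA' (typ (ordS i)) then alpha i else beta i.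

(** For i even, the links on the left enter with alpha for type A and with beta
    for type A'.  That color is [even_d i] exactly when supervertices i and i+1
    have the same type. *)
Definition same_type i := isA' (typ i) == isA' (typ (ordS i)).

(** The odd table gives {alpha, beta, gamma} to a, b, c, f and the color set of
    u_(i+1) to d, e, g, h.  These two sets may coincide or meet in beta only,
    and the same table serves for both.  The two even tables are 3-edge-colorings
    that differ in the color of the links entering c and g. *)
Definition inner_color (i : 'I_g) (l m : label) :=
  if odd i then
    match l, m with
    | Lb, Lf => alpha i
    | Lb, Le | Lc, Ld | Lf, Lh => beta i
    | Le, Lg => rim (ordS i)
    | Ld, Le | Lg, Lh => spoke (ordS i)
    | _, _ => gamma i
    end
  else if same_type i then
    match l, m with
    | Lb, Le | Lf, Lh => even_d i
    | Lb, Lf | Lc, Ld | Le, Lg => even_h i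
    | _, _ => gamma i
    end
  else
    match l, m with
    | Lb, Le | Lc, Lf | Lg, Lh => even_d i
    | Lb, Lf | Ld, Le => even_h i
    | _, _ => gamma i
    end.

Definition out_color (i : 'I_g) (l : label) :=
  if odd i then rim (ordS i) else if l is Ld then even_d i else even_h i.

(** The colors of u_i' c_i (b = false) and u_i'' g_i (b = true). *)
Definition in_color (i : 'I_g) (b : bool) :=
  if odd i && ~~ b then alpha i else beta i.

Definition arc_color (x y : svertex G typ) : 'I_5 :=
  match x, y with
  | Old w, Old z => sigma [set w; z]
  | Old w, New i _ => if w == u i then alpha i else beta i
  | New i l, New j m => if i == j then inner_color i l m else out_color i l
  | New i l, Ext _ _ => out_color i l
  | Ext e b, New i _ => in_color i b
  | Ext e _, Ext _ _ => gamma (val e)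
  | _, _ => ord0
  end.

(* [sarc] lists every edge in one orientation only, except the edges of G. *)
Definition color x y := if sarc u x y then arc_color x y else arc_color y x.

Lemma ordS_neq (i : 'I_g) : ordS i != i.
Proof.
apply/eqP=> e; have [g2 _ _] := u_cycle.
by have := ordSS_neq i g2; rewrite e e eqxx.
Qed.

Lemma ord_pred_neq (i : 'I_g) : ord_pred i != i.
Proof. by rewrite -[W in _ != W]ord_predK eq_sym ordS_neq. Qed.

Lemma adjS i : adj (u i) (u (ordS i)).
Proof. by have [] := u_cycle. Qed.

(** Outside the old edges, shadows change only along u_i a_i for i even and
    a_i u_(i+1) for i odd, along be, cd and fh in the superedges of odd index,
    and along some of the links; they always move along an edge of the cycle. *)
Lemma shadow_adj (x y : H) : adj x y ->
  shadow x = shadow y \/ adj (shadow x) (shadow y).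
Proof.
wlog xy : x y / sarc u x y.
  move=> wl; case/orP=> xy; first by apply: wl => //; apply/orP; left.
  have [||->|] := wl y x; rewrite ?(adj_sym (shadow x)) //; auto.
  by rewrite /= /sadj xy.
move=> _; case: x y xy => [w|i l|e b] [z|j m|f c] //=.
- by case/andP=> wz _; right.
- case: m => // /orP[]/eqP->; rewrite /odd_end; case: ifP => oj;
  rewrite ?adjS; auto.
  by rewrite adj_sym adjS; right.
- case/orP=> [/andP[/eqP<-]|/and3P[_ /eqP-> lm]].
  + case: l m => -[] //= _; rewrite /odd_end; case: ifP => oi; auto; right;
    by rewrite ?adjS // adj_sym adjS.
  + have : odd (ord_pred j) = ~~ odd j by rewrite odd_ord_pred.
    case: l m lm => -[] //= _ oj; rewrite /odd_end oj ord_predK;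
    by case: (odd j) => /=; auto; right; apply: adjS.
- case/andP=> /eqP->.
  have : odd (ord_pred (val f)) = ~~ odd (val f) by rewrite odd_ord_pred.
  case: c => oj /eqP-> /=; rewrite /odd_end oj ord_predK;
  by case: (odd (val f)) => /=; auto; right; apply: adjS.
- case/andP=> /eqP<-; case: b => /eqP-> /=; rewrite /odd_end;
  by case: (odd (val e)) => /=; auto; right; apply: adjS.
- by case/and3P=> /eqP-> _ _; left.
Qed.

Lemma arc_color_sym (x y : H) :
  sarc u x y -> sarc u y x -> arc_color x y = arc_color y x.
Proof.
case: x y => [w|i l|e b] [z|j m|f c] //=.
- by rewrite setUC.
- case/orP=> [/andP[/eqP<-]|/and3P[_ /eqP-> lm]].
    case: l m => -[] //= _; rewrite !andbF // orFb;
    by rewrite eq_sym (negPf (ord_pred_neq _)) andbF.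
  by case: l m lm => -[] //= _;
    rewrite !andbF ?orbF //; rewrite eq_sym (negPf (ord_pred_neq _)).
- by case: c; case/andP=> _ /eqP->; rewrite andbF.
- by case: b; case/andP=> _ /eqP->; rewrite andbF.
- by case/and3P=> /eqP-> _ ->; rewrite andbF.
Qed.

Lemma colorE (x y : H) : sarc u x y -> color x y = arc_color x y.
Proof. by rewrite /color => ->. Qed.

Lemma color_sym (x y : H) : adj x y -> color x y = color y x.
Proof.
rewrite /color; case/orP=> xy; rewrite xy; case: ifP => // yx;
exact: arc_color_sym.
Qed.

(** * The colors around each vertex *)

Local Notation star_ok x := (star_copy sigma (shadow : H -> G) color x).

(** Reduces the condition at x to a list of pairs (neighbor, color). *)
Lemma star_intro (x : H) (s : seq (H * 'I_5)) :
  size s <= 3 ->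
  all (fun p => sarc u x p.1 && (arc_color x p.1 == p.2)
             || sarc u p.1 x && (arc_color p.1 x == p.2)) s ->
  (forall y, adj x y -> y \in unzip1 s) ->
  vcolors sigma (shadow x) =i unzip2 s ->
  star_ok x.
Proof.
move=> s3 /allP s_arc s_all s_col; exists (unzip1 s); rewrite size_map.
have s_color p : p \in s -> adj x p.1 /\ color x p.1 = p.2.
  move/s_arc; case/orP=> /andP[a /eqP <-].
    by rewrite colorE //= /sadj a.
  have adjx : @adj H x p.1 by rewrite /= /sadj a orbT.
  by rewrite color_sym // colorE.
split=> // [y|].
  apply/idP/idP; first exact: s_all.
  by case/mapP=> p /s_color[] xp _ ->.
apply/setP=> c; rewrite s_col; apply/mapP/imsetP.
  by case=> p ps ->; exists p.1; [exact: map_f | case: (s_color p ps)].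
by case=> y /mapP[p ps ->] ->; exists p => //; case: (s_color p ps).
Qed.

(** The neighbor of c_i (b = false) or g_i (b = true) outside the superedge: an
    extra vertex for type A', a vertex of the previous superedge for type A. *)
Definition left_nb i (b : bool) : H :=
  if insub i is Some e then ext e b
  else new (ord_pred i) (if b then Lh else Ld).

Definition right_nb i (b : bool) : H :=
  if insub (ordS i) is Some e then ext e b
  else new (ordS i) (if b then Lg else Lc).

Lemma right_nbE i b : right_nb (ord_pred i) b =
  if insub i is Some e then ext e b else new i (if b then Lg else Lc).
Proof. by rewrite /right_nb ord_predK. Qed.

Lemma in_arc i l (z : H) : sarc u z (new i l) ->
  [\/ l = La /\ (z = old (u i) \/ z = old (u (ordS i))),
      exists2 m, superedge_arc m l & z = new i m,
      l = Lc /\ z = left_nb i false |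
      l = Lg /\ z = left_nb i true].
Proof.
case: z => [w|j m|e b] /=.
- case: l => // /orP[]/eqP->; constructor 1; auto.
- case/orP=> [/andP[/eqP-> ml]|/and3P[nA /eqP-> lm]].
    by constructor 2; exists m.
  rewrite /left_nb insubF; last exact: negbTE.
  by case: m l lm => -[] // _; [constructor 3 | constructor 4].
- case/andP=> /eqP<-; rewrite /left_nb valK.
  by case: b => /eqP->; [constructor 4 | constructor 3].
Qed.

Lemma out_arc i l (z : H) : sarc u (new i l) z ->
  [\/ exists2 m, superedge_arc l m & z = new i m,
      l = Ld /\ z = right_nb i false |
      l = Lh /\ z = right_nb i true].
Proof.
case: z => [w|j m|e b] //=.
- case/orP=> [/andP[/eqP<- ml]|/and3P[nA /eqP-> lm]].
    by constructor 1; exists m.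
  rewrite !right_nbE insubF; last exact: negbTE.
  by case: l m lm => -[] // _; [constructor 2 | constructor 3].
- case/andP=> /eqP->; rewrite !right_nbE valK.
  by case: b => /eqP->; [constructor 3 | constructor 2].
Qed.

Definition left_color (i : 'I_g) (b : bool) :=
  if odd i then (if b then beta i else alpha i)
  else if isA' (typ i) then beta i else alpha i.

Lemma odd_end_pred (i : 'I_g) : odd i -> odd_end (ord_pred i) = odd_end i.
Proof. by move=> oi; rewrite /odd_end odd_ord_pred // oi ord_predK. Qed.

Lemma alpha_even (i : 'I_g) : ~~ odd i -> alpha i = rim i.
Proof. by rewrite /alpha /odd_end => /negPf->; rewrite ordSK. Qed.

Lemma left_arc i b :
  let x := new i (if b then Lg else Lc) in
  sarc u (left_nb i b) x && (arc_color (left_nb i b) x == left_color i b).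
Proof.
rewrite /left_nb; case: insubP => [e Ae ei|nA] /=.
  rewrite ei !eqxx /= /in_color /left_color Ae.
  by case: (odd i); case: b; rewrite /= !eqxx.
rewrite nA eqxx (negPf (ord_pred_neq i)) /= /out_color /left_color (negPf nA).
rewrite odd_ord_pred // ord_predK; case: (boolP (odd i)) => oi /=.
  rewrite /even_d /even_h ord_predK (negPf nA).
  by case: b; rewrite /alpha /beta odd_end_pred ?eqxx.
by case: b; rewrite alpha_even ?eqxx ?oi.
Qed.

Lemma right_arc i b :
  let x := new i (if b then Lh else Ld) in
  sarc u x (right_nb i b) &&
  (arc_color x (right_nb i b) == out_color i (if b then Lh else Ld)).
Proof.
rewrite /right_nb; case: insubP => [e Ae ei|nA] /=.
  by rewrite ei ordSK; case: b; rewrite !eqxx.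
rewrite nA ordSK eqxx eq_sym (negPf (ordS_neq i)) /=.
by case: b; rewrite !eqxx.
Qed.

Lemma vcolors_cycle i :
  vcolors sigma (u i) = [set rim (ord_pred i); rim i; spoke i].
Proof.
have [_ _ adjE] := v_third i; apply/setP=> c; rewrite vcolorsE !inE.
have -> : rim (ord_pred i) = sigma [set u i; u (ord_pred i)].
  by rewrite ord_predK setUC.
apply/imsetP/idP.
  case=> w; rewrite -topredE /= adjE !inE -orbA => /or3P[]/eqP-> ->;
  by rewrite eqxx ?orbT.
rewrite -orbA => /or3P[]/eqP->;
  [exists (u (ord_pred i)) | exists (u (ordS i)) | exists (v i)];
  by rewrite // -topredE /= adjE !inE eqxx ?orbT.
Qed.

Lemma vcolors_odd_end i :
  vcolors sigma (u (odd_end i)) = [set alpha i; beta i; gamma i].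
Proof. exact: vcolors_cycle. Qed.

Lemma beta_odd (i : 'I_g) : odd i -> rim (ord_pred (ordS i)) = beta i.
Proof. by move=> oi; rewrite ordSK /beta /odd_end oi. Qed.

Definition nbrs (i : 'I_g) (l : label) : seq (H * 'I_5) :=
  match l with
  | La => [:: (old (u i), alpha i); (old (u (ordS i)), beta i);
              (new i Lb, inner_color i La Lb)]
  | Lb => [:: (new i La, inner_color i La Lb); (new i Le, inner_color i Lb Le);
              (new i Lf, inner_color i Lb Lf)]
  | Lc => [:: (new i Ld, inner_color i Lc Ld); (new i Lf, inner_color i Lc Lf);
              (left_nb i false, left_color i false)]
  | Ld => [:: (new i Lc, inner_color i Lc Ld); (new i Le, inner_color i Ld Le);
              (right_nb i false, out_color i Ld)]
  | Le => [:: (new i Lb, inner_color i Lb Le); (new i Ld, inner_color i Ld Le);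
              (new i Lg, inner_color i Le Lg)]
  | Lf => [:: (new i Lb, inner_color i Lb Lf); (new i Lc, inner_color i Lc Lf);
              (new i Lh, inner_color i Lf Lh)]
  | Lg => [:: (new i Le, inner_color i Le Lg); (new i Lh, inner_color i Lg Lh);
              (left_nb i true, left_color i true)]
  | Lh => [:: (new i Lf, inner_color i Lf Lh); (new i Lg, inner_color i Lg Lh);
              (right_nb i true, out_color i Lh)]
  end.

Lemma nbrs_colors i l :
  vcolors sigma (shadow (new i l)) =i unzip2 (nbrs i l).
Proof.
move=> c.
have -> : vcolors sigma (shadow (new i l)) =
  if odd i && (l \in [:: Ld; Le; Lg; Lh])
  then [set beta i; rim (ordS i); spoke (ordS i)]
  else [set alpha i; beta i; gamma i].
  have [oi|ei] := boolP (odd i).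
    by case: l; rewrite !inE /= ?oi ?vcolors_odd_end // vcolors_cycle beta_odd.
  by rewrite /= -vcolors_odd_end; case: l; rewrite /= ?(negPf ei).
case: l; rewrite !inE /= /inner_color /out_color /left_color /even_d /even_h
  /same_type; case: (odd i); rewrite /= !inE.
(* For i odd both sides list the same three colors in different orders; for i
   even this holds after the types of the two supervertices are known. *)
all: try by case: (c == alpha i); case: (c == beta i); case: (c == gamma i);
  case: (c == rim (ordS i)); case: (c == spoke (ordS i)).
all: case: (isA' (typ i)); case: (isA' (typ (ordS i))); rewrite /=;
  case: (c == alpha i); case: (c == beta i); by case: (c == gamma i).
Qed.

Lemma star_new i l : star_ok (new i l).
Proof.
have [_ u_inj _] := u_cycle.
apply: (star_intro (s := nbrs i l)); first by case: l.
- have L b := left_arc i b; have R b := right_arc i b.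
  have := L true; have := L false.
  have := R true; have := R false => /= R0 R1 L0 L1.
  case: l; rewrite /= ?R0 ?R1 ?L0 ?L1 ?eqxx ?orbT //=.
  by rewrite (inj_eq u_inj) (negPf (ordS_neq i)) eqxx.
- move=> y; rewrite /= /sadj => /orP[/out_arc|/in_arc].
    case=> [[m lm ->]|[-> ->]|[-> ->]]; rewrite ?inE ?eqxx ?orbT //.
    by case: l m lm => -[] //= _; rewrite !inE eqxx ?orbT.
  case=> [[-> [->|->]]|[m ml ->]|[-> ->]|[-> ->]]; rewrite ?inE ?eqxx ?orbT //.
  by case: m l ml => -[] //= _; rewrite !inE eqxx ?orbT.
- exact: nbrs_colors.
Qed.

Lemma star_ext e b : star_ok (ext e b).
Proof.
pose i := val e; pose j := ord_pred i; pose l := if b then Lh else Ld.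
apply: (star_intro (s := [:: (new j l, out_color j l);
  (new i (if b then Lg else Lc), in_color i b); (ext e (~~ b), gamma i)])) => //.
- by rewrite /l; case: (b); rewrite /= !eqxx ?orbT.
- case=> [w|k m|f c]; rewrite /= /sadj /= !inE //.
  + case/orP=> /andP[/eqP km /eqP->]; [rewrite -km | rewrite km];
    by rewrite -/i -/l eqxx ?orbT.
  + by case/orP=> /and3P[/eqP->]; case: (b); case: c => //= _ _;
      rewrite eqxx ?orbT.
- move=> c; rewrite vcolors_odd_end /= !inE.
  have Ai : isA' (typ i) by exact: (valP e).
  have : odd j = ~~ odd i by rewrite odd_ord_pred.
  rewrite /out_color /in_color /even_d /even_h ord_predK Ai -/i => ->.
  have [oi|ei] := boolP (odd i); rewrite /= ?ord_predK.
    have -> : alpha (ord_pred i) = alpha i by rewrite /alpha odd_end_pred.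
    have -> : beta (ord_pred i) = beta i by rewrite /beta odd_end_pred.
    by rewrite /l; case: (b); case: (c == alpha i); case: (c == beta i);
      case: (c == gamma i).
  rewrite -(alpha_even ei).
  by case: (c == alpha i); case: (c == beta i); case: (c == gamma i).
Qed.

Lemma cycle_edge_at i w : [set u i; w] \in cycle_edges u ->
  w = u (ord_pred i) \/ w = u (ordS i).
Proof.
have [_ u_inj _] := u_cycle.
case/imsetP=> j _ e; have [] := set2_eq (esym e) (adj_neq (adjS j)).
  by case=> /u_inj -> <-; right.
by case=> <- /u_inj <-; left; rewrite ordSK.
Qed.

(** The edges a_(i-1) u_i and u_i a_i carry the colors of u_(i-1) u_i and
    u_i u_(i+1), in this order for i even and exchanged for i odd; the color set
    is the same, which is why u_i can be its own shadow. *)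
Lemma star_old_cycle i : star_ok (old (u i)).
Proof.
have [_ u_inj _] := u_cycle; have [nP nS adjE] := v_third i.
have cS : [set u i; u (ordS i)] \in cycle_edges u by apply: imset_f.
have cP : [set u i; u (ord_pred i)] \in cycle_edges u.
  have : [set u (ord_pred i); u (ordS (ord_pred i))] \in cycle_edges u.
    exact: imset_f.
  by rewrite ord_predK setUC.
apply: (star_intro (s := [:: (old (v i), spoke i); (new i La, alpha i);
  (new (ord_pred i) La, beta (ord_pred i))])) => //.
- have nc : [set u i; v i] \notin cycle_edges u.
    by apply/negP=> /cycle_edge_at[]/eqP; rewrite ?(negPf nP) ?(negPf nS).
  rewrite /= adjE !inE !eqxx !orbT nc ord_predK !eqxx /=.
  by rewrite (inj_eq u_inj) eq_sym (negPf (ord_pred_neq i)) !eqxx !orbT.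
- have oldP w : adj (u i) w -> [set u i; w] \notin cycle_edges u -> w = v i.
    by rewrite adjE !inE => /or3P[]/eqP-> //; rewrite ?cS ?cP.
  case=> [w|j m|f c]; rewrite /= /sadj /= ?inE //.
  + case/orP=> /andP[iw]; last rewrite adj_sym in iw.
      by move/(oldP _ iw)->; rewrite eqxx.
    by rewrite setUC; move/(oldP _ iw)->; rewrite eqxx.
  + case: m => //; rewrite orbF => /orP[]/eqP/u_inj->;
    by rewrite ?ordSK eqxx ?orbT.
- move=> c; rewrite vcolors_cycle /= !inE.
  have [oi|ei] := boolP (odd i).
    rewrite /alpha /beta odd_end_pred // /odd_end oi.
    by case: (c == rim i); case: (c == rim _); case: (c == spoke i).
  have -> : beta (ord_pred i) = rim (ord_pred i).
    by rewrite /beta /odd_end odd_ord_pred // ei.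
  rewrite alpha_even //.
  by case: (c == rim i); case: (c == rim _); case: (c == spoke i).
Qed.

Lemma star_old w : star_ok (old w).
Proof.
have [/codomP[i ->]|nw] := boolP (w \in codom u); first exact: star_old_cycle.
have neq i : (w == u i) = false.
  by apply: contraNF nw => /eqP->; apply: codom_f.
have nc z : [set w; z] \notin cycle_edges u.
  by apply/negP=> /imsetP[i _] /setP/(_ w); rewrite !inE !neq eqxx.
apply: (star_intro (s := [seq (old z, sigma [set w; z]) | z <- enum (adj w)])).
- by rewrite size_map -cardE -(G_cubic w) cardsE.
- apply/allP=> p /mapP[z]; rewrite mem_enum => wz -> /=.
  by rewrite nc andbT eqxx andbT; apply/orP; left.
- rewrite /unzip1 -map_comp; case=> [z|j m|f c]; rewrite /= /sadj //=.
    move=> wz; apply: map_f; rewrite mem_enum -topredE /=.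
    by case/orP: wz => /andP[]; rewrite // adj_sym.
  by case: m; rewrite // !neq.
- move=> c; rewrite vcolorsE /unzip2 -map_comp.
  by apply/imsetP/mapP=> -[z wz ->]; exists z; rewrite // mem_enum in wz *.
Qed.

Lemma star x : star_ok x.
Proof.
by case: x => [w|i l|e b]; [exact: star_old | exact: star_new | exact: star_ext].
Qed.

End Lift.

(** * The normal coloring of the superposition *)

Definition superedge_arcs : seq (label * label) :=
  [:: (La, Lb); (Lb, Le); (Lb, Lf); (Lc, Ld); (Lc, Lf); (Ld, Le); (Le, Lg);
      (Lf, Lh); (Lg, Lh)].

Theorem theorem14 (G : sgraph) (sigma : {set G} -> 'I_5)
    (g : nat) (u : 'I_g -> G) (typ : 'I_g -> svtype) :
  snark G ->
  normal_coloring sigma ->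
  is_cycle u ->
  ~~ odd g ->
  exists sigma' : {set superposition u typ} -> 'I_5,
    [/\ normal_coloring sigma',
        forall a, a \in edges G :\: cycle_edges u ->
          sigma' (old_edge u typ a) = sigma a
      & 18 <= #|poor_edges sigma'|].
Proof.
move=> [G_cubic _ _] sigma_normal u_cycle g_even.
have [v v_third] := fin_all_exists (cycle_third G_cubic u_cycle).
pose H := superposition u typ.
pose f : H -> H -> 'I_5 := @color G sigma g u typ v.
pose rho : H -> G := @shadow G g u typ.
have f_sym : forall x y : H, adj x y -> f x y = f y x.
  exact: color_sym.
have rho_star (x : H) := star sigma G_cubic u_cycle g_even v_third x.
exists (recolor f ord0); split.
- apply: (recolor_normal (rho := rho) sigma_normal) => //.
  exact: shadow_adj.
- move=> a; rewrite inE => /andP[na /edgesP[x [y [xy ea]]]].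
  rewrite ea in na *; rewrite /old_edge imsetU !imset_set1.
  have xy' : sarc u (Old typ x) (Old typ y) by rewrite /= xy.
  by rewrite recolorE //= ?/sadj ?xy' // /f colorE.
- have g3 : 3 < g.
    case: u_cycle => g2 _ _; rewrite ltn_neqAle g2 andbT.
    by apply: contraNneq g_even => <-.
  pose i0 := Ordinal (leq_trans (isT : 0 < 4) g3).
  pose i2 := Ordinal (leq_trans (isT : 2 < 4) g3).
  pose e (p : 'I_g * (label * label)) : {set H} :=
    [set New G typ p.1 p.2.1; New G typ p.1 p.2.2].
  pose s := [seq e (i, q) | i <- [:: i0; i2], q <- superedge_arcs].
  suff [us sub] : uniq s /\ {subset s <= poor_edges (recolor f ord0)}.
    rewrite (leq_trans _ (subset_leq_card (introT subsetP sub))) //.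
    by rewrite (card_uniqP us).
  have arcs q : q \in superedge_arcs -> superedge_arc q.1 q.2.
    by move=> qs; apply/allP: q qs.
  split.
    apply: allpairs_uniq => // p1 p2.
    case/allpairsPdep=> i' [q' [_ /arcs qa ->]].
    case/allpairsPdep=> j' [r' [_ /arcs ra ->]] /= eqe.
    have qr : New G typ i' q'.1 != New G typ i' q'.2.
      by apply: contraTneq qa => -[->]; case: q'.2.
    case: (set2_eq eqe qr) => -[[-> e1] [e2]].
      by congr pair; apply/pair_eqP; rewrite /pair_eq /= e1 e2 !eqxx.
    (* No superedge edge is listed in both orientations. *)
    by move: qa ra; rewrite e1 e2; case: r'.1; case: r'.2.
  move=> a /allpairsP[[i q] /= [ii /arcs qa ->]].
  have adjq : @adj H (New G typ i q.1) (New G typ i q.2).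
    by rewrite /= /sadj /= eqxx qa.
  rewrite inE mem_edges //=; apply: (recolor_poor (rho := rho) sigma_normal) => //.
  have ei : odd i = false by move: ii; rewrite !inE => /orP[]/eqP->.
  by rewrite /rho /=; case: q.1; case: q.2; rewrite ?ei.
Qed.
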